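(* Let $d$ be a positive integer and let $m=\lfloor 3d/2\rfloor$. Then there are arbitrarily large integers $n$ for which there exists a $d$-regular $n\times n\times n$, $3$-partite, $3$-uniform hypergraph without repeated edges in which the maximum size of a matching is $d\cdot n/m$, that is, $\frac{2n}{3}$ if $d$ is even and $\frac{2d}{3d-1}\,n$ if $d$ is odd. In particular, for every $d\geq 4$ it is not true that every $d$-regular $n\times n\times n$, $3$-partite, $3$-uniform hypergraph without repeated edges contains a matching of size at least $\left\lceil \frac{d-1}{d}n\right\rceil$.
   Context: An $n\times n\times n$, $3$-partite, $3$-uniform hypergraph is a hypergraph whose vertex set is partitioned into three parts $X,Y,Z$ of size $n$ each and each of whose edges consists of exactly one vertex from each part. It is $d$-regular if every vertex is contained in exactly $d$ edges. A matching is a set of pairwise disjoint edges. *)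

(* Defs.v *)
From HB Require Import structures.
From mathcomp Require Import all_boot all_order all_algebra.

Set Implicit Arguments.
Unset Strict Implicit.
Unset Printing Implicit Defensive.

(* The edges form a sequence, read as a multiset (the order is irrelevant), so *)
(* that edges may a priori be repeated; [simple] excludes this.                *)
(* The parts are not packaged with finset's [partition], which forbids empty   *)
(* blocks and would not force [partX], [partY], [partZ] to be distinct.        *)
Record tripartite_hypergraph (n : nat) := TripartiteHypergraph {
  vertex : finType;
  partX : {set vertex};
  partY : {set vertex};
  partZ : {set vertex};
  edges : seq {set vertex};
  parts_cover : partX :|: partY :|: partZ = [set: vertex];
  parts_disjoint :
    [/\ [disjoint partX & partY], [disjoint partX & partZ]
      & [disjoint partY & partZ]];
  parts_card : [/\ #|partX| = n, #|partY| = n & #|partZ| = n];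
  edges_transversal : forall e, e \in edges ->
    [/\ #|e :&: partX| = 1, #|e :&: partY| = 1 & #|e :&: partZ| = 1]
}.

Section Notions.

Variables (n : nat) (H : tripartite_hypergraph n).

Definition degree (v : vertex H) : nat :=
  count (fun e : {set vertex H} => v \in e) (edges H).

Definition regular (d : nat) : Prop := forall v : vertex H, degree v = d.

Definition simple : bool := uniq (edges H).

(* Edges are nonempty, so two copies of one edge are never disjoint: a set of  *)
(* edges loses no matching even when edges are repeated.                       *)
Definition matching (M : {set {set vertex H}}) : bool :=
  (M \subset edges H) && trivIset M.

Definition matching_number : nat :=
  \max_(M : {set {set vertex H}} | matching M) #|M|.

End Notions.

(* Main.v *)
Require Import Defs.
From mathcomp Require Import all_boot all_order all_algebra.
From mathcomp Require Import zify ring lra.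

Set Implicit Arguments.
Unset Strict Implicit.
Unset Printing Implicit Defensive.

Import Order.TTheory GRing.Theory Num.Theory.
Local Open Scope ring_scope.

(** Partition the edges into intersecting families ("groups") of size [m].  A
    group has a center [a, b, c], one vertex in each part, and consists of the
    edges [abz_j], [ay_jc], [x_jbc] for [j < d/2], together with [abc] when [d]
    is odd.  Every edge contains two of [a, b, c] and so any two edges meet,
    while centers have degree [d].  Letting [d] groups with distinct centers
    share the same [d/2] outer vertices in each part gives the outer vertices
    degree [d] as well.  A matching has at most one edge per group, and a
    matching with one edge per group is obtained by using different slots (kinds
    of edges) in groups that share their outer vertices: there are
    [m >= d] slots. *)

Section Construction.

Local Open Scope nat_scope.

Variables k d : nat.

(* [inl (t, j)] is the edge whose vertex in part [t] is the [j]-th outer one;   *)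
(* the second summand is the edge [abc], and is empty when [d] is even.        *)
Definition slot : finType := ('I_3 * 'I_d./2 + 'I_(odd d))%type.
Definition group : finType := ('I_k * 'I_d)%type.
(** The first coordinate names one of [k] disjoint blocks, each made of [d] groups. Within a block,
    [inl i] is the center vertex of group [i], and [inr j] is an outer vertex common to all [d]
    groups. *)
Definition part_vertex : finType := ('I_k * ('I_d + 'I_d./2))%type.

Definition slot_vertex (g : group) (sl : slot) (t : 'I_3) : part_vertex :=
  (g.1, if sl is inl (t', j) then
          if t' == t then inr j else inl g.2
        else inl g.2).

Definition group_edge (e : group * slot) : {set 'I_3 * part_vertex} :=
  [set v | v.2 == slot_vertex e.1 e.2 v.1].

Definition part (t : 'I_3) : {set 'I_3 * part_vertex} := [set v | v.1 == t].

Lemma mem_group_edge e t u :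
  ((t, u) \in group_edge e) = (u == slot_vertex e.1 e.2 t).
Proof. by rewrite inE. Qed.

Lemma card_slot : #|slot| = d + d./2.
Proof. by rewrite card_sum card_prod !card_ord; lia. Qed.

Lemma exists_ord3_neq2 (t1 t2 : 'I_3) : exists t, (t1 != t) && (t2 != t).
Proof.
by case: t1 => [[|[|[|//]]] ?]; case: t2 => [[|[|[|//]]] ?];
  [exists 1%R | exists 2%R | exists 1%R | exists 2%R | exists 0%R | exists 0%R
  | exists 1%R | exists 0%R | exists 0%R].
Qed.

(** Each edge leaves the center in at most one of the three parts, so in some part both edges use
    the center vertex. *)
Lemma slot_vertices_meet g sl sl' :
  exists t, slot_vertex g sl t = slot_vertex g sl' t.
Proof.
have [t /andP[h1 h2]] := exists_ord3_neq2
  (if sl is inl x then x.1 else ord0) (if sl' is inl x then x.1 else ord0).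
exists t; rewrite /slot_vertex.
by case: sl h1 => [[t1 j1]|a] /= h1; case: sl' h2 => [[t2 j2]|b] /= h2;
  rewrite ?(negbTE h1) ?(negbTE h2).
Qed.

Lemma slot_vertex_inj g g' sl sl' :
  slot_vertex g sl =1 slot_vertex g' sl' -> (g, sl) = (g', sl').
Proof.
have unit_odd (a b : 'I_(odd d)) : a = b.
  by apply/val_inj; case: (odd d) a b => -[a ha] [b hb] //=; lia.
case: g g' => s i [s' i'] E.
(* In a part where neither edge is outer, the vertex is a center, which determines the group. The
   outer vertex, if any, then determines the slot. *)
have [es ei] : s = s' /\ i = i'.
  have [t /andP[h1 h2]] := exists_ord3_neq2
    (if sl is inl x then x.1 else ord0) (if sl' is inl x then x.1 else ord0).
  move: (E t); rewrite /slot_vertex.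
  by case: sl {E} h1 => [[t1 j1]|a] /= h1; case: sl' h2 => [[t2 j2]|b] /= h2;
    rewrite ?(negbTE h1) ?(negbTE h2) => -[-> ->].
congr (_, _); first by rewrite es ei.
move: E; rewrite /slot_vertex; case: sl => [[t1 j1]|a]; case: sl' => [[t2 j2]|b] E.
- by move: (E t1); rewrite eqxx; case: eqP => [-> [_ ->]|].
- by move: (E t1); rewrite eqxx.
- by move: (E t2); rewrite eqxx.
- by rewrite (unit_odd a b).
Qed.

Lemma group_edge_inj : injective group_edge.
Proof.
move=> [g sl] [g' sl'] /setP E; apply: slot_vertex_inj => t; apply/eqP.
by move: (E (t, slot_vertex g sl t)); rewrite !mem_group_edge eqxx => <-.
Qed.

Lemma degree_center t s i :
  #|[pred e | (t, (s, inl i)) \in group_edge e]| = d.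
Proof.
(* A center lies only on edges of its own group, namely those whose outer vertex is not in part [t]:
   two parts remain, which gives [2 * d./2 + odd d = d] slots. *)
pose center_slot : pred slot := fun sl => if sl is inl x then x.1 != t else true.
rewrite (@eq_card _ _ [predX pred1 (s, i) & center_slot]); last first.
  move=> [[s' i'] sl]; rewrite !inE /= /slot_vertex !xpair_eqE /=.
  rewrite (eq_sym s) /center_slot /in_mem /=.
  case: sl => [[t' j]|a] /=; last by rewrite andbT; congr andb; rewrite eq_sym.
  by case: (t' == t) => /=; rewrite ?andbF ?andbT //; congr andb; rewrite eq_sym.
rewrite cardX card1 mul1n.
have -> : #|center_slot| = #|[predX predC1 t & 'I_d./2]| + #|'I_(odd d)|.
  rewrite -sum1_card big_sumType /= !sum1_card; congr addn.
  by apply: eq_card => -[t' j]; rewrite !inE /in_mem /= andbT.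
by rewrite cardX cardC1 !card_ord; lia.
Qed.

Lemma degree_outer t s j :
  #|[pred e | (t, (s, inr j)) \in group_edge e]| = d.
Proof.
(* Each of the [d] groups of block [s] contributes exactly one edge through this outer vertex. *)
pose f i : group * slot := ((s, i), inl (t, j)).
have f_inj : injective f by move=> i i' [].
rewrite -[RHS]card_ord -(card_codom f_inj); apply: eq_card => -[[s' i] sl].
rewrite !inE /slot_vertex /= xpair_eqE; apply/idP/codomP => [|[i' [-> -> ->]]].
  case: sl => [[t' j']|a] /= /andP[/eqP <-] //.
  by case: (t' =P t) => // -> /eqP[<-]; exists i.
by rewrite !eqxx.
Qed.

Lemma parts_cover_group : part 0%R :|: part 1%R :|: part 2%R = [set: _].
Proof.
by apply/setP => -[t u]; rewrite !inE -!val_eqE /=; case: t => -[|[|[]]].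
Qed.

Lemma part_disjoint t t' : t != t' -> [disjoint part t & part t'].
Proof.
move=> tt'; rewrite -setI_eq0; apply/eqP/setP => v; rewrite !inE.
by apply/negbTE; apply: contra tt' => /andP[/eqP <- /eqP <-].
Qed.

Lemma card_part t : #|part t| = k * (d + d./2).
Proof.
rewrite (@eq_card _ _ [predX pred1 t & part_vertex]) => [|[t' u]]; last first.
  by rewrite !inE andbT.
by rewrite cardX card1 mul1n card_prod card_sum !card_ord.
Qed.

Lemma card_group_edge_part e t : #|group_edge e :&: part t| = 1.
Proof.
rewrite -[RHS](cards1 (t, slot_vertex e.1 e.2 t)); apply: eq_card => -[t' u].
by rewrite !inE xpair_eqE /= andbC; case: eqP => //= ->.
Qed.

Lemma group_edges_transversal e : e \in codom group_edge ->
  [/\ #|e :&: part 0%R| = 1, #|e :&: part 1%R| = 1 & #|e :&: part 2%R| = 1].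
Proof. by case/codomP => x ->; rewrite !card_group_edge_part. Qed.

Definition group_hypergraph : tripartite_hypergraph (k * (d + d./2)) :=
  TripartiteHypergraph parts_cover_group
    (And3 (@part_disjoint 0%R 1%R isT) (@part_disjoint 0%R 2%R isT)
      (@part_disjoint 1%R 2%R isT))
    (And3 (card_part _) (card_part _) (card_part _))
    group_edges_transversal.

Lemma group_hypergraph_simple : simple group_hypergraph.
Proof. by rewrite /simple /= map_inj_uniq ?enum_uniq //; apply: group_edge_inj. Qed.

Lemma group_hypergraph_regular : regular group_hypergraph d.
Proof.
move=> v; rewrite /degree /= count_map enumT -size_filter -cardE.
by case: v => t [s [i|j]]; [apply: degree_center | apply: degree_outer].
Qed.

Lemma matching_group_hypergraph_le (M : {set {set vertex group_hypergraph}}) :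
  matching M -> #|M| <= k * d.
Proof.
case/andP => /subsetP sM /trivIsetP tM.
pose M' := [set e | group_edge e \in M].
have -> : M = group_edge @: M'.
  apply/setP => A; apply/idP/imsetP => [AM|[e]]; last by rewrite inE => ? ->.
  by have /codomP[e eA] := sM _ AM; exists e; rewrite // inE -eA.
apply: leq_trans (leq_imset_card _ _) _.
have fst_inj : {in M' &, injective (@fst group slot)}.
  move=> [g sl] [g' sl']; rewrite !inE => eM eM' /= gg'; subst g'.
  apply: group_edge_inj; apply/eqP; apply: contraT => neq.
  have [t Et] := slot_vertices_meet g sl sl'.
  have /disjointFr/(_ (_ : (t, slot_vertex g sl t) \in _)) := tM _ _ eM eM' neq.
  by rewrite !mem_group_edge Et eqxx => /(_ isT).
rewrite -(card_in_imset fst_inj).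
by apply: leq_trans (max_card _) _; rewrite card_prod !card_ord.
Qed.

Lemma exists_slot_inj : exists f : 'I_d -> slot, injective f.
Proof.
have le : d <= #|slot| by rewrite card_slot leq_addr.
exists (fun i => enum_val (widen_ord le i)) => i i' /enum_val_inj [E].
exact: val_inj.
Qed.

Lemma exists_matching_group_hypergraph :
  exists2 M : {set {set vertex group_hypergraph}}, matching M & #|M| = k * d.
Proof.
have [f f_inj] := exists_slot_inj.
pose E (g : group) := group_edge (g, f g.2).
(* A common vertex fixes the block. Distinct groups of a block have distinct centers, so the vertex
   would be outer; then both slots agree, and injectivity of [f] identifies the groups. *)
have E_meet g g' v : v \in E g -> v \in E g' -> g = g'.
  case: g g' v => s i [s' i'] [t u]; rewrite !mem_group_edge /= => /eqP -> /eqP [->].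
  have [->|/eqP ii'] := eqVneq i i'; first by [].
  move=> eq_u; case: ii'; move: eq_u.
  case Ef: (f i) => [[t1 j1]|a]; case Ef': (f i') => [[t2 j2]|b].
  - case: (t1 =P t) => [h1|_]; case: (t2 =P t) => [h2|_] // [eij] //.
    by apply: f_inj; rewrite Ef Ef' h1 h2 eij.
  - by case: eqP => // _ [].
  - by case: eqP => // _ [].
  - by case.
have E_inj : injective E by move=> g g' /group_edge_inj [].
exists (E @: setT); last by rewrite card_imset // cardsT card_prod !card_ord.
apply/andP; split.
  by apply/subsetP => A /imsetP[g _ ->]; apply: codom_f.
apply/trivIsetP => A B /imsetP[g _ ->] /imsetP[g' _ ->] neq.
apply: contraNT neq; rewrite -setI_eq0 => /set0Pn[v /setIP[vg vg']].
by rewrite (E_meet _ _ _ vg vg').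
Qed.

Lemma matching_number_group_hypergraph :
  matching_number group_hypergraph = k * d.
Proof.
apply/eqP; rewrite eqn_leq; apply/andP; split.
  by apply/bigmax_leqP => M; apply: matching_group_hypergraph_le.
have [M matM <-] := exists_matching_group_hypergraph.
by rewrite /matching_number (bigD1 M) //= leq_maxl.
Qed.

End Construction.

Theorem mainTheorem5 (d : nat) (d_gt0 : (0 < d)%N) :
  let m := ((3 * d) %/ 2)%N in
  (forall N : nat, exists n : nat, (N <= n)%N /\
     exists H : tripartite_hypergraph n,
       [/\ regular H d,
           simple H,
           (matching_number H)%:R = d%:R * n%:R / m%:R :> rat,
           ~~ odd d -> (matching_number H)%:R = 2 * n%:R / 3 :> rat
         & odd d ->
           (matching_number H)%:R = 2 * d%:R / (3 * d%:R - 1) * n%:R :> rat])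
  /\
  ((4 <= d)%N ->
     ~ (forall (n : nat) (H : tripartite_hypergraph n),
          regular H d -> simple H ->
          exists2 M : {set {set vertex H}}, matching M &
            Num.ceil ((d%:R - 1) / d%:R * n%:R : rat) <= #|M|%:Z)).
Proof.
move=> m; have mE : m = (d + d./2)%N by rewrite /m; lia.
split=> [N|d_ge4 hall].
  (* Taking [N] blocks makes [n] at least [N], since [m] is positive. *)
  exists (N * (d + d./2))%N; split; first by nia.
  exists (group_hypergraph N d).
  rewrite matching_number_group_hypergraph mE.
  have dR : (1 : rat) <= d%:R by rewrite ler1n.
  have d2 : d%:R = (odd d)%:R + 2 * d./2%:R :> rat.
    by rewrite -natrM -natrD mul2n odd_double_half.
  have d20 : 0 <= d./2%:R :> rat by [].
  split; first exact: group_hypergraph_regular.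
  - exact: group_hypergraph_simple.
  - rewrite !natrM !natrD; field; apply: lt0r_neq0; lra.
  - move=> /negbTE odd_d; move: d2; rewrite odd_d add0r !natrM !natrD => ->.
    by field.
  - move=> odd_d; move: d2; rewrite odd_d mulr1n !natrM !natrD => d2.
    have -> : d./2%:R = (d%:R - 1) / 2 :> rat by rewrite d2; field.
    by field; apply: lt0r_neq0; lra.
(* One block suffices: [n = m] and matchings have at most [d] edges, while [d * d < (d - 1) * m]
   once [d] is at least 4. *)
have [M] := hall _ _ (@group_hypergraph_regular 1 d) (@group_hypergraph_simple 1 d).
move=> /matching_group_hypergraph_le; rewrite [leqRHS]mul1n => leM.
rewrite ceil_le_int leNgt => /negP; apply.
apply: (@le_lt_trans _ _ d%:R); first by rewrite ler_nat.
have dR : (0 : rat) < d%:R by rewrite ltr0n.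
rewrite mulrAC ltr_pdivlMr // -(natrB _ d_gt0) -!natrM ltr_nat; nia.
Qed.
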